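(* For every $m\in\mathbb{N}$, the Minkowski dimensions of $E_m^*$ and $A_m^*$ exist and $$\dim_{\rm M}E_m^*=\dim_{\rm M}A_m^*=\frac{m}{m+1}.$$
   Context: $\mathbb{N}$ is the set of positive integers. Minkowski dimension: for a non-empty bounded set $\Omega\subset\mathbb{R}$ and $r>0$, let $\mathcal{N}_r(\Omega)$ be the smallest number of closed intervals of length $r$ needed to cover $\Omega$. Put $\overline{\dim}_{\rm M}\Omega=\limsup_{r\to0^+}\frac{\log \mathcal{N}_r(\Omega)}{-\log r}$ and $\underline{\dim}_{\rm M}\Omega=\liminf_{r\to0^+}\frac{\log \mathcal{N}_r(\Omega)}{-\log r}$. If they coincide, the common value is the Minkowski dimension $\dim_{\rm M}\Omega$. Engel fractions: every rational $x\in(0,1]$ has a unique finite Engel expansion, called its Engel fraction, i.e. there is a unique finite non-decreasing sequence of positive integers $a_1\le a_2\le\cdots\le a_k$ with $$x=\frac1{a_1}+\frac1{a_1a_2}+\cdots+\frac1{a_1a_2\cdots a_k};$$ $k$ is the length of the Engel fraction of $x$. For $m\in\mathbb{N}$, $E_m^*$ is the set of all $x\in(0,1]\cap\mathbb{Q}$ whose Engel fraction has length $m$, and $A_m^*=\bigcup_{p=1}^mE_p^*$ is the set of those whose Engel fraction has length at most $m$. *)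

(* Defs.v *)
From HB Require Import structures.
From mathcomp Require Import all_boot all_order all_algebra.
From mathcomp Require Import all_classical all_reals all_analysis.
Import Order.TTheory GRing.Theory Num.Theory.
Import numFieldNormedType.Exports.

Set Implicit Arguments.
Unset Strict Implicit.
Unset Printing Implicit Defensive.

Local Open Scope classical_set_scope.
Local Open Scope ring_scope.

Definition covers_with (R : realType) (r : R) (A : set R) (n : nat) : Prop :=
  exists c : nat -> R, A `<=` \bigcup_(i < n) `[c i, c i + r]%classic.

(* The least [n] with [covers_with r A n]; junk value 0 if there is none, which
   does not happen when [A] is bounded and [0 < r]. *)
Definition covering_number (R : realType) (r : R) (A : set R) : nat :=
  xget 0%N [set n | covers_with r A n /\
                    forall k, covers_with r A k -> (n <= k)%N].

Definition covering_rate (R : realType) (A : set R) (r : R) : \bar R :=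
  (ln (covering_number r A)%:R / - ln r)%:E.

Definition upper_minkowski_dim (R : realType) (A : set R) : \bar R :=
  limf_esup (covering_rate A) 0^'+.

Definition lower_minkowski_dim (R : realType) (A : set R) : \bar R :=
  limf_einf (covering_rate A) 0^'+.

Definition has_minkowski_dim (R : realType) (A : set R) (d : \bar R) : Prop :=
  [/\ A !=set0, bounded_set A,
      upper_minkowski_dim A = d & lower_minkowski_dim A = d].

Definition engel_sum (R : realType) (s : seq nat) : R :=
  \sum_(j < size s) (\prod_(i < j.+1) (nth 0%N s i)%:R)^-1.

Definition is_engel_fraction (R : realType) (x : R) (s : seq nat) : Prop :=
  [/\ all (fun a => 0 < a)%N s, sorted leq s & x = engel_sum R s].

Arguments engel_sum : clear implicits.

(* Every rational in (0, 1] has exactly one Engel fraction, so the existential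
   below says that its length is [m]. *)
Definition engel_length_eq (R : realType) (m : nat) : set R :=
  [set x | [/\ 0 < x <= 1, rational x &
               exists2 s : seq nat, is_engel_fraction x s & size s = m]].

Arguments engel_length_eq R m : clear implicits.

Definition engel_length_le (R : realType) (m : nat) : set R :=
  \bigcup_(p in [set p | 1 <= p <= m]%N) engel_length_eq R p.

Arguments engel_length_le R m : clear implicits.

(* Main.v *)
(* Upper bound, by induction on m: an Engel sum of length at most m + 1 is 0 or
   (1 + y) / a with y of length at most m.  With t = r ^ (-1 / (m + 2)), the sums
   with a <= t form rescaled copies of the sums of length at most m, which need
   about (r a) ^ (- m / (m + 1)) intervals each, and those with a > t lie in an
   interval of length O(1 / t).  Both parts need O(t ^ (m + 1)) intervals.

   Lower bound: two distinct Engel sums of length m with non-decreasing digits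
   in [2, B] differ by at least B ^ (- (m + 1)).  Choosing the digits freely in m
   consecutive blocks of length A gives A ^ m such points with B = (m + 1) A, and
   one takes A comparable to r ^ (-1 / (m + 1)). *)

Require Import Defs.
From mathcomp Require Import all_boot all_order all_algebra.
From mathcomp Require Import all_classical all_reals all_analysis.
From mathcomp Require Import zify ring lra.
Import Order.TTheory GRing.Theory Num.Theory.
Import numFieldNormedType.Exports.
Local Open Scope classical_set_scope.
Local Open Scope ring_scope.

(** * Engel sums: recursion, size bounds and separation *)

Lemma engel_sum_nil (R : realType) : engel_sum R [::] = 0.
Proof. by rewrite /engel_sum big_ord0. Qed.

Lemma engel_sum_cons (R : realType) (a : nat) (s : seq nat) :
  engel_sum R (a :: s) = (1 + engel_sum R s) / a%:R.
Proof.
rewrite /engel_sum /= big_ord_recl big_ord_recl big_ord0 mulr1 mulrDl mul1r.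
congr (_ + _); rewrite mulr_suml; apply: eq_bigr => j _.
by rewrite big_ord_recl invfM mulrC.
Qed.

Lemma engel_sum_ge0 (R : realType) (s : seq nat) : 0 <= engel_sum R s.
Proof.
elim: s => [|a s IHs]; first by rewrite engel_sum_nil.
by rewrite engel_sum_cons divr_ge0// addr_ge0.
Qed.

Lemma engel_sum_le_size (R : realType) (s : seq nat) :
  all (fun a => 0 < a)%N s -> engel_sum R s <= (size s)%:R.
Proof.
elim: s => [|a s IHs] /=; first by rewrite engel_sum_nil.
move=> /andP[a0 /IHs s0]; rewrite engel_sum_cons ler_pdivrMr ?ltr0n//.
rewrite (@le_trans _ _ (1 + (size s)%:R)) ?lerD2l// -natr1 addrC ler_peMr//.
by rewrite ler1n.
Qed.

(** The bound is the value of the infinite expansion with all digits [b + 1], since 1/b = (1 + 1/b)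
    / (b + 1). A finite sum with digits at least [b + 1] falls short of it. *)
Lemma engel_sum_lt_inv (R : realType) (b : nat) (s : seq nat) :
  (0 < b)%N -> all (fun a => b < a)%N s -> engel_sum R s < b%:R^-1.
Proof.
move=> b0; elim: s => [|a s IHs] /=.
  by rewrite engel_sum_nil invr_gt0 ltr0n.
move=> /andP[ba /IHs lt_s]; rewrite engel_sum_cons.
have bR : (0 : R) < b%:R by rewrite ltr0n.
have baR : b%:R + 1 <= a%:R :> R by rewrite natr1 ler_nat.
rewrite ltr_pdivrMr; last by lra.
apply: (@lt_le_trans _ _ (1 + b%:R^-1)); first by rewrite ltrD2l.
by rewrite -[X in X + _](mulVf (lt0r_neq0 bR)) -[X in _ + X]mulr1 -mulrDr
  ler_pM2l ?invr_gt0.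
Qed.

Lemma engel_sum_rational (R : realType) (s : seq nat) :
  rational (engel_sum R s).
Proof.
elim: s => [|a s [q _ qE]].
  by exists 0 => //; rewrite engel_sum_nil rmorph0.
exists ((1 + q) / a%:R) => //.
by rewrite engel_sum_cons fmorph_div rmorphD rmorph1 rmorph_nat -qE.
Qed.

(** The digits of the second sum exceed a' - 1, so that sum is below 1/(a' - 1) <= 1/a, while a
    second digit b puts the first sum at 1/a + 1/(ab) or more. If the tails are empty, the gap is
    1/a - 1/a' >= 1/(aa'). Equal lengths matter: long sums with all digits a + 1 come arbitrarily
    close to 1/a. *)
Lemma engel_sum_sep_head (R : realType) (a a' : nat) (t t' : seq nat)
    (B : nat) :
  (1 < a)%N -> (a < a' <= B)%N -> size t = size t' ->
  all (fun x => 0 < x <= B)%N t -> all (leq a') t' ->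
  (B%:R ^+ 2)^-1 <= engel_sum R (a :: t) - engel_sum R (a' :: t').
Proof.
move=> a1 /andP[aa' a'B] st tB t'a'.
have [aR a'R aa'R a'BR] : [/\ (0 : R) < a%:R, (0 : R) < a'%:R,
    a%:R + 1 <= a'%:R :> R & a'%:R <= B%:R :> R].
  by rewrite !ltr0n natr1 !ler_nat; split => //; lia.
have le2 (x y : R) : 0 < x <= B%:R -> 0 < y <= B%:R ->
    (B%:R ^+ 2)^-1 <= (x * y)^-1.
  move=> /andP[x0 xB] /andP[y0 yB].
  rewrite lef_pV2 ?posrE ?exprn_gt0 ?mulr_gt0//; last lra.
  by rewrite expr2 ler_pM// ltW.
case: t st tB => [|b t] /= st tB.
  rewrite (size0nil (esym st)) !engel_sum_cons !engel_sum_nil.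
  apply: (le_trans (le2 a%:R a'%:R _ _)); [by lra|by lra|].
  have -> : (1 + 0) / a%:R - (1 + 0) / a'%:R
      = (a%:R * a'%:R)^-1 * (a'%:R - a%:R) :> R.
    by field; rewrite !pnatr_eq0; lia.
  by rewrite ler_peMr ?invr_ge0 ?mulr_ge0//; lra.
have {tB}[bR bBR] : (0 : R) < b%:R /\ b%:R <= B%:R :> R.
  by move: tB => /andP[/andP[b0 bB] _]; rewrite ltr0n ler_nat.
have a'E : a'%:R = a'.-1%:R + 1 :> R by rewrite natr1 prednK//; lia.
have lt_a' : engel_sum R (a' :: t') < a%:R^-1.
  apply: (@lt_le_trans _ _ a'.-1%:R^-1).
    apply: engel_sum_lt_inv; first by lia.
    have lt_pred x : (a' <= x -> a'.-1 < x)%N by lia.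
    by rewrite /= lt_pred//=; apply: sub_all t'a' => x /lt_pred.
  by rewrite lef_pV2 ?posrE ?ltr0n ?ler_nat; lia.
apply: (le_trans (le2 a%:R b%:R _ _)); [by lra|by lra|].
rewrite lerBrDr; apply: (@le_trans _ _ ((a%:R * b%:R)^-1 + a%:R^-1)).
  by rewrite lerD2l ltW.
have -> : (a%:R * b%:R)^-1 + a%:R^-1 = (1 + b%:R^-1) / a%:R :> R.
  by field; rewrite !lt0r_neq0.
rewrite engel_sum_cons ler_pM2r ?invr_gt0// lerD2l engel_sum_cons.
by rewrite ler_peMl ?invr_ge0 ?(ltW bR)// lerDl engel_sum_ge0.
Qed.

(** Each common leading digit costs a factor of at most [B]. There are at most m - 1 of them before
    the digits differ, and there [engel_sum_sep_head] gives B^(-2). *)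
Lemma engel_sum_sep (R : realType) (B m : nat) (s s' : seq nat) :
  size s = m -> size s' = m -> sorted leq s -> sorted leq s' ->
  all (fun a => 1 < a <= B)%N s -> all (fun a => 1 < a <= B)%N s' ->
  s != s' ->
  (B%:R ^+ m.+1)^-1 <= `|engel_sum R s - engel_sum R s'|.
Proof.
elim: m s s' => [|m IHm] [|a s] [|a' s'] //= [ss] [ss'] so so'.
move=> /andP[/andP[a1 aB] sB] /andP[/andP[a'1 a'B] s'B].
have BR : (1 : R) <= B%:R by rewrite ler1n; lia.
have [->|neq_a] := eqVneq a a'.
  rewrite eqseq_cons eqxx /= => neq_s; rewrite !engel_sum_cons -mulrBl.
  have -> : 1 + engel_sum R s - (1 + engel_sum R s')
     = engel_sum R s - engel_sum R s' by ring.
  rewrite normrM exprSr invfM.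
  apply: ler_pM; rewrite ?invr_ge0 ?exprn_ge0//.
    by apply: IHm => //; [exact: path_sorted so|exact: path_sorted so'].
  by rewrite ger0_norm ?invr_ge0// lef_pV2 ?posrE ?ltr0n ?ler_nat//; lia.
move=> _.
apply: (@le_trans _ _ (B%:R ^+ 2)^-1).
  rewrite lef_pV2 ?posrE ?exprn_gt0 ?(lt_le_trans ltr01)//.
  by rewrite ler_weXn2l.
have sub x : (1 < x <= B -> 0 < x <= B)%N by lia.
have [lt|lt|eqa] := ltngtP a a'; last by rewrite eqa eqxx in neq_a.
  apply: (le_trans _ (ler_norm _)).
  apply: engel_sum_sep_head => //; first by rewrite lt.
  - by rewrite ss.
  - exact: sub_all sB.
  - exact: order_path_min leq_trans so'.
rewrite distrC; apply: (le_trans _ (ler_norm _)).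
apply: engel_sum_sep_head => //; first by rewrite lt.
- by rewrite ss.
- exact: sub_all s'B.
- exact: order_path_min leq_trans so.
Qed.

(** * Operations on covers by intervals of length [r] *)

Lemma covers_with_subset (R : realType) (r : R) (A B : set R) (n : nat) :
  A `<=` B -> covers_with r B n -> covers_with r A n.
Proof. by move=> AB [c Bc]; exists c; exact: subset_trans Bc. Qed.

Lemma covers_withU (R : realType) (r : R) (A B : set R) (n k : nat) :
  covers_with r A n -> covers_with r B k -> covers_with r (A `|` B) (n + k).
Proof.
move=> [c Ac] [d Bd].
exists (fun i => if (i < n)%N then c i else d (i - n)%N).
move=> x [/Ac[i /= i_n xi]|/Bd[i /= i_k xi]].
  by exists i => /=; rewrite ?i_n//; lia.
by exists (n + i)%N => /=; rewrite ?ltn_add2l// addKn ifF//; lia.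
Qed.

Lemma covers_with_bigcup (R : realType) (r : R) (A : nat -> set R)
    (n : nat -> nat) (k : nat) :
  (forall i, (i < k)%N -> covers_with r (A i) (n i)) ->
  covers_with r (\bigcup_(i < k) A i) (\sum_(i < k) n i).
Proof.
elim: k => [_|k IHk cover].
  by rewrite big_ord0; exists (fun=> 0) => x [].
rewrite big_ord_recr /=; apply: (@covers_with_subset _ _ _
    (\bigcup_(i < k) A i `|` A k)).
  move=> x [i /=]; rewrite ltnS leq_eqVlt => /orP[/eqP -> Akx|ik Aix].
    by right.
  by left; exists i.
by apply: covers_withU (cover k _) => //; apply: IHk => i /ltnW; exact: cover.
Qed.

Lemma covers_with_itv (R : realType) (r L : R) (n : nat) :
  0 < r -> L < n%:R * r -> covers_with r `[0, L] n.
Proof.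
(* The point x lies in the interval whose index is the floor of x/r; strictness of [L < n%:R * r]
   keeps that index below [n]. *)
move=> r0 Ln; exists (fun i => i%:R * r) => x /=; rewrite in_itv/= => /andP[x0 xL].
have /(truncn_itv)/andP[] : 0 <= x / r by rewrite divr_ge0// ltW.
set i := Num.truncn _; rewrite ler_pdivlMr// ltr_pdivrMr// => ix xi.
exists i => /=.
  by rewrite -(ltr_nat R) -(ltr_pM2r r0); exact: le_lt_trans (le_lt_trans xL Ln).
by rewrite in_itv/= ix -[X in _ + X]mul1r -mulrDl natr1 ltW.
Qed.

(** By [engel_sum_cons], this map prepends the digit [a] to an Engel sum; it divides lengths by
    [a]. *)
Lemma covers_with_affine (R : realType) (r a : R) (A : set R) (n : nat) :
  0 < a -> covers_with (r * a) A n ->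
  covers_with r [set (1 + x) / a | x in A] n.
Proof.
move=> a0 [c Ac]; exists (fun i => (1 + c i) / a) => _ [x /Ac[i /= i_n xi] <-].
exists i => //=; move: xi; rewrite !in_itv/= => /andP[cx xc].
rewrite ler_pM2r ?invr_gt0// lerD2l cx /= ler_pdivrMr// mulrDl.
by rewrite divfK ?lt0r_neq0// -addrA lerD2l.
Qed.

(** * Upper bound for the number of covering intervals *)

(** A discrete integral comparison by telescoping. With u and v the (m+1)-th roots of k + 1 and k, 1
    = u^(m+1) - v^(m+1) is u - v times a sum of m + 1 terms, each at most u^m. *)
Lemma sum_powR_le (R : realType) (m k : nat) :
  \sum_(i < k) (i.+1%:R : R) `^ (- (m%:R / m.+1%:R))
    <= m.+1%:R * (k%:R : R) `^ m.+1%:R^-1.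
Proof.
elim: k => [|k IHk]; first by rewrite big_ord0 mulr_ge0// powR_ge0.
rewrite big_ord_recr /=; apply: le_trans (lerD IHk (lexx _)) _.
rewrite -lerBrDl -mulrBr.
set u := k.+1%:R `^ m.+1%:R^-1; set v := k%:R `^ _.
have v0 : 0 <= v by exact: powR_ge0.
have u0 : 0 < u by rewrite powR_gt0// ltr0n.
have vu : v <= u by apply: ge0_ler_powR; rewrite ?nnegrE ?invr_ge0 ?ler_nat.
have rootX (x : R) : 0 <= x -> (x `^ m.+1%:R^-1) ^+ m.+1 = x.
  by move=> x0; rewrite -powR_mulrn ?powR_ge0// -powRrM mulVf// powRr1.
have -> : (k.+1%:R : R) `^ (- (m%:R / m.+1%:R)) = (u ^+ m)^-1.
  by rewrite powRN mulrC powRrM powR_mulrn// ltW.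
rewrite -[X in X <= _]mul1r ler_pdivrMr ?exprn_gt0//.
apply: (@le_trans _ _ (u ^+ m.+1 - v ^+ m.+1)).
  by rewrite !rootX// -natr1 addrAC subrr add0r.
rewrite subrXX [_ * (u - v)]mulrC -mulrA ler_wpM2l ?subr_ge0//.
have -> : m.+1%:R * u ^+ m = \sum_(i < m.+1) u ^+ m.
  by rewrite sumr_const card_ord mulr_natl.
apply: ler_sum => i _ /=.
have -> : u ^+ m = u ^+ (m - i) * u ^+ i.
  by rewrite -exprD subnK// -ltnS.
by rewrite ler_wpM2l ?exprn_ge0 ?(ltW u0)// lerXn2r ?nnegrE// ltW.
Qed.

(** Digits may come in any order and the empty sequence is allowed, so that the tails of the
    sequences for [m.+1] range over the sequences for [m]. *)
Lemma covers_with_engel_sums (R : realType) (m : nat) :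
  exists2 C : R, 0 < C & forall r : R, 0 < r <= 1 -> exists2 n : nat,
    n%:R <= C * r `^ (- (m%:R / m.+1%:R)) &
    covers_with r [set engel_sum R s | s in
      [set s : seq nat | all (fun a => 0 < a)%N s && (size s <= m)%N]] n.
Proof.
elim: m => [|m [C C0 IHm]].
  exists 1 => // r /andP[r0 _]; exists 1%N.
    by rewrite mul0r oppr0 powRr0 mulr1.
  exists (fun=> 0) => x [s /= /andP[_]]; rewrite leqn0 => /nilP -> <-.
  by exists 0%N => //=; rewrite engel_sum_nil in_itv/= add0r lexx ltW.
(* The first term pays for first digits up to [t], with the factor m + 1 of [sum_powR_le]. The
   second pays for the interval [0, (m+1)/t], which needs (m+1) t^(m+1) pieces up to rounding. *)
exists (C * m.+1%:R + m.+2%:R); first by rewrite addr_gt0// mulr_gt0.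
move=> r /andP[r0 r1].
pose t := r `^ (- m.+2%:R^-1).
have t1 : 1 <= t.
  by rewrite -[X in X <= _](powRr0 r) ger_powR ?r0// oppr_le0 invr_ge0.
have t0 : 0 < t by exact: lt_le_trans t1.
have powt x : t `^ x = r `^ (- (x / m.+2%:R)).
  by rewrite -powRrM mulNr mulrC.
have tr : t ^+ m.+2 = r^-1.
  by rewrite -powR_mulrn ?ltW// powt divff// powR_inv1 ?ltW.
have rt : r = t `^ (- m.+2%:R) by rewrite powRN powR_mulrn ?ltW// tr invrK.
pose k := Num.truncn t.
have /andP[kt tk] := truncn_itv (ltW t0); rewrite -/k in kt tk.
pose S := [set engel_sum R s | s in
  [set s : seq nat | all (fun a => 0 < a)%N s && (size s <= m)%N]].
(* The induction hypothesis at scale ra requires ra <= 1, which follows from a <= t <= t^(m+2) =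
   1/r. *)
have ra_le1 i : (i < k)%N -> 0 < r * i.+1%:R <= 1.
  move=> ik; rewrite mulr_gt0//= -ler_pdivlMl// mulr1 -tr.
  apply: (@le_trans _ _ t); last by rewrite exprS ler_peMr ?exprn_ege1// ltW.
  by apply: le_trans kt; rewrite ler_nat.
(* Index [i] stands for the first digit i + 1; from [k] on, 0 is a placeholder. *)
have /choice[n nP] : forall i, exists n : nat, (i < k)%N ->
    n%:R <= C * (r * i.+1%:R) `^ (- (m%:R / m.+1%:R)) /\
    covers_with (r * i.+1%:R) S n.
  move=> i; have [ik|ki] := ltnP i k; last by exists 0%N.
  by have [n nC Sn] := IHm _ (ra_le1 _ ik); exists n.
exists (\sum_(i < k) n i + (Num.truncn (m.+1%:R * t ^+ m.+1)).+1)%N; last first.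
  apply: (@covers_with_subset _ _ _
    ((\bigcup_(i < k) [set (1 + x) / i.+1%:R | x in S]) `|`
     `[0, m.+1%:R / t])).
    move=> _ [[|a s] /= + <-].
      by right; rewrite /= engel_sum_nil in_itv/= lexx divr_ge0// ltW.
    move=> /andP[/andP[a0 s0] sm]; have [ak|ka] := leqP a k.
      left; exists a.-1; first by rewrite /=; lia.
      rewrite prednK//; exists (engel_sum R s); last by rewrite engel_sum_cons.
      by exists s => //=; rewrite s0.
    (* Here a >= k + 1 > t, and the tail sum is at most its length, hence at most m. *)
    right; rewrite /= in_itv/= engel_sum_ge0/= engel_sum_cons.
    rewrite ler_pM ?invr_ge0 ?addr_ge0 ?engel_sum_ge0//.
      rewrite -natr1 addrC lerD2r (le_trans (engel_sum_le_size _ _ s0))// ler_nat.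
      by rewrite -ltnS.
    rewrite lef_pV2 ?posrE ?ltr0n//; apply: (le_trans (ltW tk)).
    by rewrite ler_nat.
  apply: covers_withU.
    apply: covers_with_bigcup => i ik; apply: covers_with_affine => //.
    by have [] := nP i ik.
  apply: covers_with_itv => //; rewrite -ltr_pdivrMr//.
  have -> : m.+1%:R / t / r = m.+1%:R * t ^+ m.+1.
    by rewrite -tr exprS -mulrA mulKf ?lt0r_neq0.
  exact: truncnS_gt.
have -> : r `^ (- (m.+1%:R / m.+2%:R)) = t ^+ m.+1.
  by rewrite -powR_mulrn ?ltW// powt.
rewrite natrD mulrDl lerD//; last first.
  rewrite -[X in X <= _]natr1 -[m.+2%:R]natr1 mulrDl mul1r lerD ?exprn_ege1//.
  by rewrite truncn_le mulr_ge0// exprn_ge0 ?ltW.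
rewrite natr_sum; apply: (@le_trans _ _ (\sum_(i < k)
   C * r `^ (- (m%:R / m.+1%:R)) * i.+1%:R `^ (- (m%:R / m.+1%:R)))).
  apply: ler_sum => i _; have [+ _] := nP i (ltn_ord i).
  by rewrite powRM ?(ltW r0)// mulrA.
rewrite -mulr_sumr -!mulrA ler_pM2l//.
apply: (le_trans (ler_wpM2l (powR_ge0 _ _) (sum_powR_le R m k))).
rewrite mulrCA ler_pM2l//.
apply: (@le_trans _ _ (r `^ (- (m%:R / m.+1%:R)) * t `^ m.+1%:R^-1)).
  rewrite ler_wpM2l ?powR_ge0//.
  by apply: ge0_ler_powR; rewrite ?nnegrE ?invr_ge0// ltW.
rewrite [in X in X `^ _ * _]rt -powRrM -powRD; last first.
  by rewrite (gt_eqF t0) /= implybT.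
rewrite -powR_mulrn ?(ltW t0)//.
(* The exponents add up because m(m+2) + 1 = (m+1)^2. *)
suff -> : - m.+2%:R * - (m%:R / m.+1%:R) + m.+1%:R^-1 = m.+1%:R :> R by [].
rewrite -[m.+2%:R]natr1 -[m.+1%:R]natr1; field.
by rewrite natr1.
Qed.

(** * From two-sided covering bounds to the Minkowski dimension *)

(** Once some finite cover exists, a least one does, so [xget] does not return its default 0. *)
Lemma covering_number_spec (R : realType) (r : R) (A : set R) (n : nat) :
  covers_with r A n ->
  covers_with r A (covering_number r A) /\ (covering_number r A <= n)%N.
Proof.
move=> An; have exA : exists k, `[< covers_with r A k >].
  by exists n; apply/asboolP.
have [k /asboolP Ak mink] := ex_minnP exA.
have [|AN minN] := @xgetPex _ 0%N [set n | covers_with r A n /\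
    forall k, covers_with r A k -> (n <= k)%N].
  by exists k; split => // j Aj; apply: mink; apply/asboolP.
by split => //; exact: minN.
Qed.

(** The upper limit is the infimum, over the sets of [F], of the suprema of [f]. The set where [f]
    is [e]-close to [d] bounds it above; every set of [F] meets this one, which bounds it below. *)
Lemma limf_esup_eq (R : realType) (F : set_system R) (f : R -> R) (d : R) :
  ProperFilter F ->
  (forall e, 0 < e -> \forall x \near F, `|f x - d| <= e) ->
  limf_esup (fun x => (f x)%:E) F = d%:E.
Proof.
move=> FF fd; apply/eqP; rewrite eq_le; apply/andP; split.
  apply/lee_addgt0Pr => e /fd Fe; apply: ereal_inf_le.
  exists (ereal_sup [set (f x)%:E | x in [set x | `|f x - d| <= e]]).
    by exists [set x | `|f x - d| <= e].
  apply: ge_ereal_sup => _ [x /= xe <-].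
  by rewrite -EFinD lee_fin -lerBlDl; exact: le_trans (ler_norm _) xe.
apply: le_ereal_inf_tmp => _ [V FV <-].
apply/lee_subgt0Pr => e /fd Fe.
have [x [/= xe Vx]] := filter_ex (filterI Fe FV).
apply: le_ereal_sup_tmp; exists (f x)%:E; first by exists x.
rewrite -EFinB lee_fin lerBlDr -lerBlDl.
by move: xe; rewrite distrC; exact: le_trans (ler_norm _).
Qed.

(** Taking logarithms, ln N differs from -d ln r by at most |ln c| + |ln C|, and this error vanishes
    after division by -ln r. *)
Lemma has_minkowski_dim_powR (R : realType) (A : set R) (d c C : R) :
  A !=set0 -> bounded_set A -> 0 < c -> 0 < C ->
  (\forall r \near 0^'+, exists2 n : nat,
      n%:R <= C * r `^ (- d) & covers_with r A n) ->
  (\forall r \near 0^'+, forall n : nat,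
      covers_with r A n -> c * r `^ (- d) <= n%:R) ->
  has_minkowski_dim A d%:E.
Proof.
move=> A0 bA c0 C0 upA loA.
have rate e : 0 < e -> \forall r \near 0^'+,
    `|ln (covering_number r A)%:R / - ln r - d| <= e.
  move=> e0; pose M := `|ln c| + `|ln C|.
  near=> r.
  have r0 : 0 < r by near: r; exact: nbhs_right_gt.
  have r1 : r < 1 by near: r; exact: nbhs_right_lt.
  (* This threshold makes the error [M] smaller than e times -ln r. *)
  have rM : r < expR (- (M / e)).
    by near: r; apply: nbhs_right_lt; exact: expR_gt0.
  have [n nC An] : exists2 n : nat,
      n%:R <= C * r `^ (- d) & covers_with r A n by near: r.
  have cA : forall n : nat, covers_with r A n -> c * r `^ (- d) <= n%:R.
    by near: r.
  have [AN Nn] := covering_number_spec _ _ _ _ An.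
  have {cA AN} cN := cA _ AN.
  have {nC} NC : (covering_number r A)%:R <= C * r `^ (- d).
    by apply: le_trans nC; rewrite ler_nat.
  set N := (covering_number r A)%:R in cN NC *.
  have rd0 : 0 < r `^ (- d) by rewrite powR_gt0.
  have N0 : 0 < N by apply: lt_le_trans cN; rewrite mulr_gt0.
  have lnr0 : ln r < 0 by rewrite ln_lt0// r0.
  have eL : M < e * - ln r.
    by rewrite mulrC -ltr_pdivrMr// ltrNr -ltr_expR lnK.
  have lnNC : ln N <= ln C + - d * ln r.
    by rewrite -ln_powR -lnM ?posrE// ler_ln ?posrE// mulr_gt0.
  have lncN : ln c + - d * ln r <= ln N.
    by rewrite -ln_powR -lnM ?posrE// ler_ln ?posrE// mulr_gt0.
  have -> : ln N / - ln r - d = (ln N - d * - ln r) / - ln r.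
    by field; rewrite ltr0_neq0.
  rewrite normrM normfV (gtr0_norm (x := - ln r)) ?oppr_gt0//.
  rewrite ler_pdivrMr ?oppr_gt0//; apply: le_trans (ltW eL).
  have := ler_norm (ln C); have := ler_norm (- ln c).
  have := normr_ge0 (ln C); have := normr_ge0 (ln c); rewrite normrN /M.
  by move=> *; rewrite ler_norml; apply/andP; split; lra.
split => //; first exact: limf_esup_eq.
(* The lower limit is minus the upper limit of the opposite function, to which the same estimate
   applies. *)
rewrite /lower_minkowski_dim /limf_einf.
rewrite (limf_esup_eq _ _ (fun r => - (ln (covering_number r A)%:R / - ln r))
  (- d)) ?EFinN ?oppeK// => e /rate; apply: filterS => r.
by rewrite -opprD normrN.
Unshelve. all: by end_near.
Qed.

(** * Lower bound from separated points with digits in blocks *)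

(* Digits in the successive blocks [iA + 2, (i + 1)A + 2) are automatically
   increasing, so that they can be chosen independently. *)
Definition block_digits (A m : nat) (f : {ffun 'I_m.+1 -> 'I_A}) : seq nat :=
  mkseq (fun i => i * A + 2 + f (inord i))%N m.+1.

Lemma size_block_digits (A m : nat) (f : {ffun 'I_m.+1 -> 'I_A}) :
  size (block_digits A m f) = m.+1.
Proof. exact: size_mkseq. Qed.

Lemma block_digits_inj (A m : nat) : injective (block_digits A m).
Proof.
move=> f g fg; apply/ffunP => i; apply: val_inj => /=.
have := congr1 (fun s => nth 0%N s i) fg.
by rewrite !nth_mkseq// inord_val; lia.
Qed.

Lemma sorted_block_digits (A m : nat) (f : {ffun 'I_m.+1 -> 'I_A}) :
  sorted leq (block_digits A m f).
Proof.
apply/(sortedP 0%N) => i; rewrite size_block_digits => im.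
rewrite !nth_mkseq//; last exact: ltnW.
by have := ltn_ord (f (inord i)); rewrite mulSn; lia.
Qed.

Lemma block_digits_bounds (A m : nat) (f : {ffun 'I_m.+1 -> 'I_A}) :
  all (fun a => 1 < a <= m.+2 * A)%N (block_digits A m f).
Proof.
apply/(all_nthP 0%N) => i; rewrite size_block_digits => im.
rewrite nth_mkseq//; have := ltn_ord (f (inord i)).
have : (i * A <= m * A)%N by rewrite leq_mul2r; apply/orP; right.
by rewrite !mulSn; lia.
Qed.

Lemma engel_length_eq_block_digits (R : realType) (A m : nat)
    (f : {ffun 'I_m.+1 -> 'I_A}) :
  engel_length_eq R m.+1 (engel_sum R (block_digits A m f)).
Proof.
have gt1 : all (fun a => 1 < a)%N (block_digits A m f).
  by apply: sub_all (block_digits_bounds A m f) => a /andP[].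
have gt0 : all (fun a => 0 < a)%N (block_digits A m f).
  by apply: sub_all gt1 => a; exact: ltnW.
split; last by exists (block_digits A m f);
  [split=> //; exact: sorted_block_digits|exact: size_block_digits].
  apply/andP; split; last first.
    by have := engel_sum_lt_inv R 1 _ isT gt1; rewrite invr1 => /ltW.
  have := size_block_digits A m f; move: gt0.
  case: block_digits => //= a s /andP[a0 _] _.
  by rewrite engel_sum_cons divr_gt0 ?ltr0n// ltr_pwDl ?engel_sum_ge0.
exact: engel_sum_rational.
Qed.

(** Pigeonhole: the block sums are more than [r] apart, by [engel_sum_sep] with B = (m+2)A, so
    sending each to the index of an interval containing it is injective. *)
Lemma leq_expn_covers_with (R : realType) (A m n : nat) (r : R) :
  r < ((m.+2 * A)%:R ^+ m.+2)^-1 ->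
  covers_with r (engel_length_eq R m.+1) n -> (A ^ m.+1 <= n)%N.
Proof.
move=> rA [c Ec].
have /choice[h hP] : forall f : {ffun 'I_m.+1 -> 'I_A}, exists i : 'I_n,
    c i <= engel_sum R (block_digits A m f) <= c i + r.
  move=> f; have [i /= i_n] := Ec _ (engel_length_eq_block_digits R A m f).
  by rewrite in_itv/=; exists (Ordinal i_n).
rewrite -[X in (X ^ _)%N]card_ord -[X in (_ ^ X)%N]card_ord -card_ffun.
rewrite -[X in (_ <= X)%N]card_ord; apply: (@leq_card _ _ h) => f g hfg.
apply/eqP/negPn/negP => fg.
have neq : block_digits A m f != block_digits A m g.
  by apply: contra_neq fg; exact: block_digits_inj.
have := engel_sum_sep R _ _ _ _ (size_block_digits A m f)
  (size_block_digits A m g) (sorted_block_digits A m f)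
  (sorted_block_digits A m g) (block_digits_bounds A m f)
  (block_digits_bounds A m g) neq.
move=> /(lt_le_trans rA); rewrite ltNge ler_norml => /negP; apply.
have := hP f; have := hP g; rewrite hfg => /andP[? ?] /andP[? ?].
by apply/andP; split; lra.
Qed.

Lemma covers_with_engel_length_eq_ge (R : realType) (m : nat) : exists2 c : R,
  0 < c & \forall r \near 0^'+, forall n : nat,
    covers_with r (engel_length_eq R m.+1) n ->
    c * r `^ (- (m.+1%:R / m.+2%:R)) <= n%:R.
Proof.
(* One factor 2 in the 4 leaves room for (m+2)A <= t/2 < t; the other absorbs the rounding of
   [A]. *)
pose q : R := 4 * m.+2%:R.
have m2 : (0 : R) < m.+2%:R by rewrite ltr0n.
have q0 : 0 < q by rewrite /q; lra.
exists (q^-1 ^+ m.+1); first by rewrite exprn_gt0// invr_gt0.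
near=> r => n En.
have r0 : 0 < r by near: r; exact: nbhs_right_gt.
have rq : r < (q ^+ m.+2)^-1.
  by near: r; apply: nbhs_right_lt; rewrite invr_gt0 exprn_gt0.
pose t := r `^ (- m.+2%:R^-1).
have t0 : 0 < t by rewrite powR_gt0.
have powt x : t `^ x = r `^ (- (x / m.+2%:R)).
  by rewrite -powRrM mulNr mulrC.
have tr : t ^+ m.+2 = r^-1.
  by rewrite -powR_mulrn ?ltW// powt divff// powR_inv1 ?ltW.
have r_lt x : 0 < x -> (r < (x ^+ m.+2)^-1) = (x < t).
  move=> x0; rewrite -[r]invrK -tr ltf_pV2 ?posrE ?exprn_gt0//.
  by rewrite ltr_pXn2r// nnegrE ltW.
have qt : q < t by rewrite -r_lt.
pose A := Num.truncn (t / (2 * m.+2%:R)).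
have /andP[tA At] : A%:R <= t / (2 * m.+2%:R) < A.+1%:R.
  by apply: truncn_itv; rewrite divr_ge0 ?ltW// mulr_gt0.
rewrite -natr1 in At.
(* As t > q, the number t / (2(m+2)) = 2t/q is at least t/q + 1, and [A] is less than 1 below it. *)
have tq : q^-1 * t <= A%:R.
  have tE : t / (2 * m.+2%:R) = q^-1 * t + q^-1 * t.
    by rewrite /q; field; rewrite lt0r_neq0.
  have : 1 <= q^-1 * t by rewrite mulrC ler_pdivlMr// mul1r ltW.
  by move: At; rewrite tE; set x := q^-1 * t; lra.
have A0 : (0 : R) < A%:R by apply: lt_le_trans tq; rewrite mulr_gt0 ?invr_gt0.
have rA : r < ((m.+2 * A)%:R ^+ m.+2)^-1.
  rewrite r_lt natrM ?mulr_gt0//; apply: (@le_lt_trans _ _ (t / 2)); last by lra.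
  have -> : t / 2 = m.+2%:R * (t / (2 * m.+2%:R)) by field; rewrite lt0r_neq0.
  by rewrite ler_pM2l.
rewrite -powt powR_mulrn ?(ltW t0)// -exprMn.
apply: (@le_trans _ _ (A ^ m.+1)%:R).
  by rewrite natrX lerXn2r// nnegrE ltW// mulr_gt0// invr_gt0.
by rewrite ler_nat (leq_expn_covers_with _ _ _ _ _ rA En).
Unshelve. all: by end_near.
Qed.

Theorem theorem1p6 (R : realType) (m : nat) (hm : (0 < m)%N) :
  has_minkowski_dim (engel_length_eq R m) (m%:R / m.+1%:R)%:E /\
  has_minkowski_dim (engel_length_le R m) (m%:R / m.+1%:R)%:E.
Proof.
case: m hm => // m _.
(* Through this inclusion the upper bound passes down to the smaller set and the lower bound up to
   the larger one. *)
have eq_le : engel_length_eq R m.+1 `<=` engel_length_le R m.+1.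
  by move=> x Ex; exists m.+1 => //=; rewrite leqnn.
have eq0 : engel_length_eq R m.+1 !=set0.
  (* With blocks of length 1 the digits are 2, 3, ..., m + 2. *)
  by exists (engel_sum R (block_digits 1 m [ffun=> ord0]));
    exact: engel_length_eq_block_digits.
have le_bounded B : B `<=` engel_length_le R m.+1 -> bounded_set B.
  move=> BE; exists 1; split => // M M1 x /BE[p _ [/andP[x0 x1] _ _]].
  by rewrite /= ger0_norm ?ltW// (le_lt_trans x1).
have [C C0 covE] := covers_with_engel_sums R m.+1.
have [c c0 cE] := covers_with_engel_length_eq_ge R m.
have cov_le : \forall r \near 0^'+, exists2 n : nat,
    n%:R <= C * r `^ (- (m.+1%:R / m.+2%:R)) &
    covers_with r (engel_length_le R m.+1) n.
  near=> r; have [|n nC En] := covE r.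
    by apply/andP; split; [near: r; exact: nbhs_right_gt
      |near: r; exact: nbhs_right_le].
  exists n => //; apply: covers_with_subset En.
  move=> x [p /= /andP[_ pm] [_ _ [s [s0 _ ->] sp]]].
  by exists s => //=; rewrite s0 sp.
split.
  apply: (has_minkowski_dim_powR _ _ _ _ _ _ _ c0 C0) => //.
    exact: le_bounded.
  apply: filterS cov_le => r [n nC En]; exists n => //.
  exact: covers_with_subset En.
apply: (has_minkowski_dim_powR _ _ _ _ _ _ _ c0 C0) => //.
- by case: eq0 => x /eq_le; exists x.
- exact: le_bounded.
apply: filterS cE => r cr n En; apply: cr.
exact: covers_with_subset En.
Unshelve. all: by end_near.
Qed.
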